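(* Let $p$ be a prime, $e,r\ge 1$ integers, $s\geq 0$ an integer, and let $R=GR(p^e,r)$ be the Galois ring of characteristic $p^e$ and cardinality $p^{er}$. Let $\alpha,\beta$ be units of $R$ and assume there exists a unit $\alpha_0\in R$ with $\alpha_0^{p^s}=\alpha$. Then the ring $\mathcal{R}(\alpha,\beta)=R[x]/\langle x^{p^s}-(\alpha+\beta p)\rangle$ is a chain ring with maximal ideal $\langle \alpha_0^{-1}x-1\rangle$ and residue field $\mathbb{F}_{p^r}$, and the nilpotency index of $\alpha_0^{-1}x-1$ is $ep^s$. The ideals of $\mathcal{R}(\alpha,\beta)$ are $\langle(\alpha_0^{-1}x-1)^i\rangle$, $0\le i\le ep^s$.
   Context: A (finite) chain ring is a finite commutative local principal ideal ring with $1\ne 0$ whose ideals are totally ordered by inclusion. The Galois ring $GR(p^e,r)$ is $\mathbb{Z}_{p^e}[x]/(f(x))$ where $f$ is a monic polynomial of degree $r$ whose reduction modulo $p$ is irreducible in $\mathbb{F}_p[x]$; it is unique up to isomorphism, local with maximal ideal $\langle p\rangle$ and residue field $\mathbb{F}_{p^r}$. The nilpotency index of a nilpotent element $a$ is the least integer $k\geq 1$ with $a^k=0$. *)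

(* Defs.v *)
From HB Require Import structures.
From mathcomp Require Import all_boot all_order all_algebra.

Set Implicit Arguments.
Unset Strict Implicit.
Unset Printing Implicit Defensive.

Import GRing.Theory.
Local Open Scope ring_scope.

(* {poly %/ h} has its finite and its ring structures in the library, but not
   their join. *)
HB.instance Definition _ (R : finComNzRingType) (h : {poly R}) :=
  Finite.on {poly %/ h}.

Section FiniteCommutativeRing.

Variable T : finComNzRingType.
Implicit Types (I J M : {set T}) (a : T).

(* The library's idealr_closed only covers proper ideals. *)
Definition is_ideal I : Prop :=
  zmod_closed I /\ forall a, {in I, forall u, a * u \in I}.

Definition principal_ideal a : {set T} := [set u * a | u : T].

Definition maximal_ideal M : Prop :=
  [/\ is_ideal M, M != [set: T]
    & forall I, is_ideal I -> M \subset I -> I = M \/ I = [set: T]].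

(* Finiteness, commutativity and 1 != 0 are carried by the type of T. *)
Definition chain_ring : Prop :=
  [/\ exists! M, maximal_ideal M,
      forall I, is_ideal I -> exists a, I = principal_ideal a
    & forall I J, is_ideal I -> is_ideal J -> I \subset J \/ J \subset I].

(* T / M is isomorphic to the field with q elements; as I =i M, {ideal_quot I} is
   T / M. *)
Definition has_residue_field M (q : nat) : Prop :=
  exists2 F : finFieldType, #|F| = q &
    exists2 I : idealr T, I =i M &
      exists phi : {rmorphism {ideal_quot I} -> F}, bijective phi.

Definition nilpotency_index a (k : nat) : Prop :=
  [/\ (0 < k)%N, a ^+ k = 0
    & forall j, (0 < j)%N -> a ^+ j = 0 -> (k <= j)%N].

End FiniteCommutativeRing.

Arguments chain_ring : clear implicits.

(* Meaningful for p prime and e > 0: 'Z_n is the ring of integers mod n only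
   when n > 1. *)
Definition Zpe_to_Fp (p e : nat) (a : 'Z_(p ^ e)) : 'F_p := (a : nat)%:R.

(* R is (a copy of) GR(p^e, r), for p prime and e, r > 0; then f is monic of
   size > 1, so {poly %/ f} is the quotient by f itself. *)
Definition galois_ring (p e r : nat) (R : finComNzRingType) : Prop :=
  exists f : {poly 'Z_(p ^ e)},
    [/\ f \is monic, size f = r.+1,
        irreducible_poly (map_poly (@Zpe_to_Fp p e) f)
      & exists phi : {rmorphism {poly %/ f} -> R}, bijective phi].

(* The modulus of R[x] / <x^n - c>; for n > 0 it is monic of size > 1. *)
Definition constacyclic_poly (R : comNzRingType) (n : nat) (c : R) : {poly R} :=
  'X^n - c%:P.

(* Main.v *)
From HB Require Import structures.
Require Import Defs.
From mathcomp Require Import all_boot all_order all_algebra all_field.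

(* Put q = p^s and y = alpha0^-1 x - 1. Since
   (1 + y)^q = 1 + y^q + p y g for some g, the relation x^q = alpha + beta p
   reads y^q = p (beta / alpha - y g). Hence y is nilpotent, the cofactor is a
   unit, and p is associated to y^q. Reduction mod p followed by evaluation at
   alpha0 maps the quotient ring onto the residue field of R with kernel <y>, so
   every element is a unit times a power of y. The exponent e q is sharp because
   p^(e-1) y^(q-1) is a polynomial of degree q - 1 < deg h with leading
   coefficient p^(e-1) alpha0^(1-q) != 0. *)

Set Implicit Arguments.
Unset Strict Implicit.
Unset Printing Implicit Defensive.

Import GRing.Theory.
Local Open Scope ring_scope.

(** Factor [u - x = u (1 - x v)] and invert [1 - x v] by a finite geometric series, [x v] being
    nilpotent. *)
Lemma unit_sub_nilpotent (T : comNzRingType) (u v x : T) (n : nat) :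
  u * v = 1 -> x ^+ n = 0 -> exists w, (u - x) * w = 1.
Proof.
move=> uv1 xn0; exists (v * \sum_(i < n) (x * v) ^+ i).
have -> : u - x = u * (1 - x * v) by rewrite mulrBr mulr1 mulrCA uv1 mulr1.
rewrite mulrACA uv1 mul1r -opprB mulNr -subrX1.
by rewrite exprMn xn0 mul0r sub0r opprK.
Qed.

Lemma principal_idealP (R : finComNzRingType) (a b : R) :
  reflect (exists u, b = u * a) (b \in principal_ideal a).
Proof.
apply: (iffP imsetP) => [[u _ ->]|[u ->]]; first by exists u.
by exists u.
Qed.

Lemma principal_ideal_is_ideal (R : finComNzRingType) (a : R) :
  is_ideal (principal_ideal a).
Proof.
split=> [|b _ /principal_idealP[u ->]].
  split=> [|_ _ /principal_idealP[u ->] /principal_idealP[v ->]].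
    by apply/principal_idealP; exists 0; rewrite mul0r.
  by apply/principal_idealP; exists (u - v); rewrite mulrBl.
by apply/principal_idealP; exists (b * u); rewrite mulrA.
Qed.

(** * Rings with a surjection onto a field whose kernel has a nilpotent generator *)

Section NilpotentGenerator.

Variables (T : finComNzRingType) (F : finFieldType) (phi : {rmorphism T -> F}).
Variables (y : T) (N : nat).
Hypothesis phi_surj : forall z, exists a, phi a = z.
Hypothesis ker_phi : forall a, phi a = 0 -> exists b, a = b * y.
Hypothesis phi_y : phi y = 0.
Hypothesis y_nil : nilpotency_index y N.

Let yN0 : y ^+ N = 0. Proof. by case: y_nil. Qed.

Lemma mem_ker_phi a : (a \in principal_ideal y) = (phi a == 0).
Proof.
apply/principal_idealP/eqP => [[u ->]|/ker_phi//].
by rewrite rmorphM phi_y mulr0.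
Qed.

(** If [b] lifts the inverse of [phi a], then [a b = 1 - c y], which is [1] minus a nilpotent. *)
Lemma unit_of_phi_neq0 a : phi a != 0 -> exists b, a * b = 1.
Proof.
move=> a0; have [b phib] := phi_surj (phi a)^-1.
have /ker_phi[c abE] : phi (1 - a * b) = 0.
  by rewrite rmorphB rmorphM rmorph1 phib mulfV ?subrr.
have [//||w ww] := @unit_sub_nilpotent T 1 1 (c * y) N; first by rewrite mulr1.
  by rewrite exprMn yN0 mulr0.
exists (b * w); rewrite mulrA -ww; congr (_ * _).
by rewrite -abE subKr.
Qed.

(** Factors [y] are split off as long as the cofactor lies in the kernel. Either the cofactor
    becomes a unit on the way, or [y ^+ N] divides [a] and [a = 0]. *)
Lemma unit_mul_power a :
  exists u v j, [/\ u * v = 1, (j <= N)%N & a = u * y ^+ j].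
Proof.
suff H n : (n <= N)%N -> (exists b, a = b * y ^+ n) \/
    exists u v j, [/\ u * v = 1, (j <= N)%N & a = u * y ^+ j].
  have [[b ->]|//] := H N (leqnn N).
  (* Zero counts as [1 * y ^+ N]. *)
  by exists 1, 1, N; rewrite mulr1 yN0 !mulr0.
elim: n => [_|n IHn ltnN]; first by left; exists a; rewrite mulr1.
have [[b aE]|] := IHn (ltnW ltnN); last by right.
have [/ker_phi[c bE]|/unit_of_phi_neq0[v bv1]] := eqVneq (phi b) 0.
  by left; exists c; rewrite exprS mulrA -bE.
by right; exists b, v, n; split=> //; exact: ltnW.
Qed.

(** The generator is the least power of [y] in [I], which exists because [y ^+ N = 0] lies in [I].
    If [u * y ^+ j] is in [I] with [u] a unit, so is [y ^+ j], and minimality bounds [j] from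
    below. *)
Lemma ideal_principal_power I : is_ideal I ->
  exists2 i, (i <= N)%N & I = principal_ideal (y ^+ i).
Proof.
move=> [[I0 _] idI]; have exI : exists i, y ^+ i \in I by exists N; rewrite yN0.
case: (ex_minnP exI) => i yiI min_i; exists i; first by rewrite min_i ?yN0.
apply/setP=> a; apply/idP/principal_idealP => [aI|[u ->]]; last exact: idI.
have [u [v [j [uv1 _ aE]]]] := unit_mul_power a.
have /min_i lij : y ^+ j \in I.
  by rewrite -[y ^+ j]mul1r -uv1 mulrAC -aE mulrC idI.
by exists (u * y ^+ (j - i)); rewrite -mulrA -exprD subnK.
Qed.

Lemma is_idealP I : is_ideal I <->
  exists2 i, (i <= N)%N & I = principal_ideal (y ^+ i).
Proof.
split=> [|[i _ ->]]; first exact: ideal_principal_power.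
exact: principal_ideal_is_ideal.
Qed.

Lemma principal_power_sub i j : (i <= j)%N ->
  principal_ideal (y ^+ j) \subset principal_ideal (y ^+ i).
Proof.
move=> le_ij; apply/subsetP=> _ /principal_idealP[u ->].
apply/principal_idealP; exists (u * y ^+ (j - i)).
by rewrite -mulrA -exprD subnK.
Qed.

Lemma ideal_setT_or_sub I : is_ideal I ->
  I = [set: T] \/ I \subset principal_ideal y.
Proof.
move=> /ideal_principal_power[[|i] _ ->]; [left | right].
  apply/setP=> a; rewrite inE; apply/principal_idealP.
  by exists a; rewrite mulr1.
by rewrite -[y in X in _ \subset X]expr1 principal_power_sub.
Qed.

Lemma principal_neq_setT : principal_ideal y != [set: T].
Proof.
apply/eqP => /setP/(_ 1); rewrite inE mem_ker_phi rmorph1.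
by rewrite oner_eq0.
Qed.

Lemma maximal_principal : maximal_ideal (principal_ideal y).
Proof.
split; [exact: principal_ideal_is_ideal | exact: principal_neq_setT |].
move=> I /ideal_setT_or_sub[|Iy yI]; [by right | left].
by apply/eqP; rewrite eqEsubset Iy.
Qed.

Lemma chain_ring_nilpotent_generator : chain_ring T.
Proof.
split=> [|I /ideal_principal_power[i _ ->]|]; last 2 first.
- by exists (y ^+ i).
- move=> I J /ideal_principal_power[i _ ->] /ideal_principal_power[j _ ->].
  by have [/principal_power_sub|/ltnW/principal_power_sub] := leqP i j; auto.
exists (principal_ideal y); split=> [|M [idM nTM maxM]].
  exact: maximal_principal.
(* Uniqueness: a maximal [M] is proper, hence inside [<y>], and its maximality leaves only
   [M = <y>]. *)
have [MT|My] := ideal_setT_or_sub idM; first by rewrite MT eqxx in nTM.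
have [//|yT] := maxM _ (principal_ideal_is_ideal y) My.
by have := principal_neq_setT; rewrite yT eqxx.
Qed.

(** The kernel as a predicate, so that it can carry the [idealr] structure from which [ideal_quot]
    is formed. *)
Definition ker_pred : {pred T} := fun a => phi a == 0.

Lemma ker_idealr_closed : idealr_closed ker_pred.
Proof.
split=> [||a u v]; rewrite !unfold_in ?rmorph0 ?rmorph1 ?oner_eq0 //.
by move=> /eqP u0 /eqP v0; rewrite rmorphD rmorphM u0 v0 mulr0 addr0.
Qed.

HB.instance Definition _ := isIdealr.Build T ker_pred ker_idealr_closed.

Definition ker_ideal : idealr T := ker_pred.

Definition quot_phi (x : {ideal_quot ker_ideal}) : F := phi (repr x).

(** The chosen representative of the class of [a] differs from [a] by an element of the kernel. *)
Lemma quot_phiE a : quot_phi (\pi_({ideal_quot ker_ideal})%qT a) = phi a.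
Proof.
apply/eqP; rewrite -subr_eq0 -rmorphB.
have := Quotient.idealrBE ker_ideal
  (repr (\pi_({ideal_quot ker_ideal})%qT a)) a.
by rewrite unfold_in => ->; rewrite reprK.
Qed.

Lemma quot_phi_zmod_morphism : zmod_morphism quot_phi.
Proof.
by elim/quotW=> a; elim/quotW=> b; rewrite -rmorphB !quot_phiE rmorphB.
Qed.

Lemma quot_phi_monoid_morphism : monoid_morphism quot_phi.
Proof.
split=> [|].
  by rewrite -(rmorph1 \pi_({ideal_quot ker_ideal})%qT) quot_phiE rmorph1.
by elim/quotW=> a; elim/quotW=> b; rewrite -rmorphM !quot_phiE rmorphM.
Qed.

HB.instance Definition _ := GRing.isZmodMorphism.Build _ _ quot_phi
  quot_phi_zmod_morphism.
HB.instance Definition _ := GRing.isMonoidMorphism.Build _ _ quot_phi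
  quot_phi_monoid_morphism.

(** First isomorphism theorem: the inverse sends [z] to the class of a chosen preimage under
    [phi]. *)
Lemma residue_field_principal : has_residue_field (principal_ideal y) #|F|.
Proof.
exists F => //; exists ker_ideal.
  by move=> a; rewrite mem_ker_phi.
exists quot_phi.
have phi_surjb z : exists a, phi a == z.
  by have [a <-] := phi_surj z; exists a.
pose lift z := xchoose (phi_surjb z).
have liftK z : phi (lift z) = z by exact/eqP/(xchooseP (phi_surjb z)).
exists (fun z => \pi_({ideal_quot ker_ideal})%qT (lift z)) => [|z].
  elim/quotW=> a /=; rewrite quot_phiE; apply/eqP.
  by rewrite -Quotient.idealrBE unfold_in rmorphB liftK subrr.
exact: etrans (quot_phiE _) (liftK z).
Qed.

End NilpotentGenerator.

(** * Ring morphisms out of a polynomial quotient *)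

Section QpolyLift.

Variables (A : comNzRingType) (B : comNzRingType) (h : {poly A}).
Variable g : {rmorphism {poly A} -> B}.
Hypothesis gh0 : g (mk_monic h) = 0.

(** Elements of [{poly %/ h}] are polynomials reduced modulo [mk_monic h], so the map induced by [g]
    can be read off the representative. *)
Definition qpoly_lift (a : {poly %/ h}) : B := g (a : {poly A}).

Lemma qpoly_lift_in_qpoly p : qpoly_lift (in_qpoly h p) = g p.
Proof.
rewrite [in RHS](Pdiv.RingMonic.rdivp_eq (monic_mk_monic h) p).
by rewrite rmorphD rmorphM gh0 mulr0 add0r.
Qed.

Lemma in_qpolyK (a : {poly %/ h}) : in_qpoly h a = a.
Proof. by apply/val_inj/in_qpoly_small/size_mk_monic. Qed.

Lemma in_qpolyC c : in_qpoly h c%:P = qpolyC h c.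
Proof. exact: in_qpolyK (qpolyC h c). Qed.

Lemma qpoly_lift_zmod_morphism : zmod_morphism qpoly_lift.
Proof. by move=> a b; rewrite /qpoly_lift -rmorphB. Qed.

Lemma qpoly_lift_monoid_morphism : monoid_morphism qpoly_lift.
Proof.
split=> [|a b]; first exact: rmorph1.
(* The product of two representatives need not be reduced; writing [a] and [b] as classes makes
   [a * b] the class of that product. *)
rewrite -[a in LHS]in_qpolyK -[b in LHS]in_qpolyK -rmorphM qpoly_lift_in_qpoly.
exact: rmorphM.
Qed.

HB.instance Definition _ := GRing.isZmodMorphism.Build _ _ qpoly_lift
  qpoly_lift_zmod_morphism.
HB.instance Definition _ := GRing.isMonoidMorphism.Build _ _ qpoly_lift
  qpoly_lift_monoid_morphism.

Definition qpoly_rmorphism : {rmorphism {poly %/ h} -> B} := qpoly_lift.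

End QpolyLift.

Lemma mk_monic_id (A : nzSemiRingType) (h : {poly A}) :
  h \is monic -> (1 < size h)%N -> mk_monic h = h.
Proof. by rewrite /mk_monic => -> ->. Qed.

(** * Reduction from the integers mod [p^e] to the prime field *)

Section ZpeToFp.

Variables (p e : nat).
Hypotheses (p_pr : prime p) (e_gt0 : (0 < e)%N).

Let pe_gt1 : (1 < p ^ e)%N.
Proof. by rewrite -(exp1n e) ltn_exp2r ?prime_gt1. Qed.

Lemma natr_mod_prime_power m : (m %% p ^ e)%:R = m%:R :> 'F_p.
Proof.
by rewrite -Fp_nat_mod // modn_dvdm ?Fp_nat_mod // dvdn_exp.
Qed.

Lemma Zpe_to_Fp_nat m : Zpe_to_Fp (p := p) (e := e) m%:R = m%:R.
Proof. by rewrite /Zpe_to_Fp val_Zp_nat // natr_mod_prime_power. Qed.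

Lemma Zpe_to_Fp_zmod_morphism : zmod_morphism (@Zpe_to_Fp p e).
Proof.
have fD x y : @Zpe_to_Fp p e (x + y) = Zpe_to_Fp x + Zpe_to_Fp y.
  by rewrite -[x]natr_Zp -[y]natr_Zp -natrD !Zpe_to_Fp_nat natrD.
by move=> x y; apply/eqP; rewrite eq_sym subr_eq -fD subrK.
Qed.

Lemma Zpe_to_Fp_monoid_morphism : monoid_morphism (@Zpe_to_Fp p e).
Proof.
split=> [|x y]; first by rewrite -[1]/(1%:R) Zpe_to_Fp_nat.
by rewrite -[x]natr_Zp -[y]natr_Zp -natrM !Zpe_to_Fp_nat natrM.
Qed.

Lemma Zpe_to_Fp_eq0 (x : 'Z_(p ^ e)) :
  Zpe_to_Fp x = 0 -> x = ((x : nat) %/ p)%:R * p%:R.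
Proof.
move=> /(congr1 val) /=; rewrite val_Fp_nat // => /eqP/divnK xE.
by rewrite -natrM xE natr_Zp.
Qed.

HB.instance Definition _ := GRing.isZmodMorphism.Build _ _ (@Zpe_to_Fp p e)
  Zpe_to_Fp_zmod_morphism.
HB.instance Definition _ := GRing.isMonoidMorphism.Build _ _ (@Zpe_to_Fp p e)
  Zpe_to_Fp_monoid_morphism.

(** Named so that the proofs of primality and positivity behind the morphism structure can be passed
    explicitly. *)
Definition Zpe_rmorphism : {rmorphism 'Z_(p ^ e) -> 'F_p} := @Zpe_to_Fp p e.

Lemma map_Zpe_to_Fp_eq0 (a : {poly 'Z_(p ^ e)}) :
  map_poly (@Zpe_to_Fp p e) a = 0 -> exists b, a = b * p%:R%:P.
Proof.
move=> a0; exists (\poly_(i < size a) ((a`_i)%R %/ p)%:R).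
apply/polyP=> i; rewrite coefMC coef_poly.
have /Zpe_to_Fp_eq0 : Zpe_to_Fp a`_i = 0.
  by rewrite -(coef_map Zpe_rmorphism) /= a0 coef0.
by case: ltnP => // /leq_sizeP/(_ i (leqnn i)) ->; rewrite mul0r.
Qed.

Lemma map_Zpe_to_Fp_surj (b : {poly 'F_p}) :
  exists a, map_poly (@Zpe_to_Fp p e) a = b.
Proof.
exists (\poly_(i < size b) ((b`_i)%R : nat)%:R); apply/polyP=> i.
rewrite (coef_map Zpe_rmorphism) /= coef_poly.
case: ltnP => [_|/leq_sizeP/(_ i (leqnn i)) ->].
  by rewrite Zpe_to_Fp_nat natr_Zp.
exact: (rmorph0 Zpe_rmorphism).
Qed.

End ZpeToFp.

(** * Residue field and characteristic of a Galois ring *)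

Section GaloisRing.

Variables (p e r : nat) (R : finComNzRingType).
Hypotheses (p_pr : prime p) (e_gt0 : (0 < e)%N) (r_gt0 : (0 < r)%N).
Hypothesis galR : galois_ring p e r R.

Let pe_gt1 : (1 < p ^ e)%N.
Proof. by rewrite -(exp1n e) ltn_exp2r ?prime_gt1. Qed.

(** [pi] is the inverse of the given isomorphism followed by coefficientwise reduction modulo [p],
    with values in [F_p[x]] modulo the reduced [f]. *)
Lemma galois_ring_residue : exists2 F : finFieldType, #|F| = (p ^ r)%N &
  exists2 pi : {rmorphism R -> F}, (forall z, exists a, pi a = z) &
    forall a, pi a = 0 -> exists b, a = b * p%:R.
Proof.
have [f [f_mon sz_f irr_f [phi [psi phiK psiK]]]] := galR.
pose red := Zpe_rmorphism p_pr e_gt0.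
have fbar_mon : map_poly red f \is monic by rewrite monic_map.
have sz_fbar : size (map_poly red f) = r.+1.
  by rewrite size_map_poly_id0 ?sz_f // (eqP f_mon) rmorph1 oner_eq0.
have mi : monic_irreducible_poly (map_poly red f) by [].
have mkf : mk_monic f = f by rewrite mk_monic_id ?sz_f.
have mkfbar : mk_monic (map_poly red f) = map_poly red f.
  by rewrite mk_monic_id ?sz_fbar.
pose F : finFieldType := {poly %/ map_poly red f with mi}.
pose g : {rmorphism {poly 'Z_(p ^ e)} -> {poly %/ map_poly red f}} :=
  in_qpoly (map_poly red f) \o map_poly red.
have gf0 : g (mk_monic f) = 0.
  apply/val_inj; rewrite mkf /= mkfbar.
  by rewrite Pdiv.RingMonic.rmodpp.
exists F; first by rewrite card_qfpoly card_Fp // sz_fbar.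
have psiA : zmod_morphism psi by exact: can2_zmod_morphism phiK psiK.
have psiM : monoid_morphism psi by exact: can2_monoid_morphism phiK psiK.
pose psiR : {rmorphism R -> {poly %/ f}} := HB.pack psi
  (GRing.isZmodMorphism.Build _ _ psi psiA)
  (GRing.isMonoidMorphism.Build _ _ psi psiM).
pose pi : {rmorphism R -> {poly %/ map_poly red f}} :=
  qpoly_rmorphism gf0 \o psiR.
exists pi => [z|a].
  have [b bE] := map_Zpe_to_Fp_surj p_pr e_gt0 z.
  exists (phi (in_qpoly f b)).
  apply: etrans (congr1 (qpoly_lift g) (phiK _)) _.
  by rewrite qpoly_lift_in_qpoly //= bE; exact: in_qpolyK.
(* [f] and its reduction have the same degree, so the reduced representative needs no further
   division: all its coefficients vanish modulo [p]. *)
move=> /(congr1 val) /=; rewrite Pdiv.Ring.rmodp_small => [|]; last first.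
  rewrite mkfbar sz_fbar (leq_ltn_trans (size_poly _ _)) //.
  by have := size_mk_monic (psi a); rewrite {2}mkf sz_f.
move=> /(map_Zpe_to_Fp_eq0 p_pr e_gt0)[b aE].
exists (phi (in_qpoly f b)); rewrite -[LHS]psiK -(rmorph_nat phi) -rmorphM.
congr (phi _); rewrite -[LHS]in_qpolyK aE rmorphM.
by rewrite polyC_natr rmorph_nat.
Qed.

Lemma galois_ring_natr_eq0 n : (n%:R == 0 :> R) = (p ^ e %| n)%N.
Proof.
have [f [_ _ _ [phi phi_bij]]] := galR.
rewrite -(rmorph_nat phi) -(rmorph0 phi) (inj_eq (bij_inj phi_bij)).
rewrite -val_eqE /= qpolyC_natr -polyC_natr polyC_eq0.
by rewrite -val_eqE /= val_Zp_nat.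
Qed.

End GaloisRing.

(** * Binomial expansion of prime powers: the middle coefficients are divisible by [p], and the
    middle terms by [x] *)

Lemma expr1D_prime (T : comNzRingType) (p : nat) (x : T) : prime p ->
  exists g, (1 + x) ^+ p = 1 + x ^+ p + p%:R * x * g.
Proof.
case: p => [|n] // p_pr.
exists (\sum_(i < n) ('C(n.+1, i.+1) %/ n.+1)%:R * x ^+ i).
rewrite exprDn big_ord_recl big_ord_recr /= bin0 binn subnn !expr0 mul1r.
rewrite !mulr1n !expr1n mul1r [X in _ + X]addrC addrA; congr (_ + _ + _).
rewrite mulr_sumr; apply: eq_bigr => i _; rewrite /bump add1n expr1n mul1r.
have /divnK {1}<- : (n.+1 %| 'C(n.+1, i.+1))%N.
  by rewrite prime_dvd_bin //= ltnS ltn_ord.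
by rewrite -mulr_natl natrM exprS [_ * n.+1%:R]mulrC mulrACA.
Qed.

(** Induction on [s]: the expansion at [q] has the form [1 + x d], to which the prime case applies.
    Keeping the factor [x] in the error term is what later makes that term nilpotent at [y]. *)
Lemma expr1D_prime_power (T : comNzRingType) (p s : nat) (x : T) : prime p ->
  exists g, (1 + x) ^+ (p ^ s) = 1 + x ^+ (p ^ s) + p%:R * x * g.
Proof.
move=> p_pr; elim: s => [|s [g IHs]].
  by exists 0; rewrite !expr1 mulr0 addr0.
set q := (p ^ s)%N in IHs *.
have q_gt0 : (0 < q)%N by rewrite expn_gt0 prime_gt0.
pose d := x ^+ q.-1 + p%:R * g.
have xdE : x * d = x ^+ q + p%:R * x * g.
  by rewrite mulrDr -exprS prednK // mulrCA mulrA.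
have [k xd1E] := expr1D_prime (x * d) p_pr.
(* [x d] and [x^q] differ by [p x g], and the difference of two [p]-th powers is divisible by the
   difference of the bases. *)
have [l xdpE] : exists l, (x * d) ^+ p = x ^+ q ^+ p + p%:R * x * l.
  exists (g * \sum_(i < p) (x * d) ^+ (p.-1 - i) * x ^+ q ^+ i).
  by apply/eqP; rewrite addrC -subr_eq subrXX mulrA xdE addrAC subrr add0r.
exists (l + d * k).
rewrite expnSr !exprM -/q IHs -addrA -xdE xd1E xdpE.
by rewrite [in RHS]mulrDr !addrA !mulrA.
Qed.

(** * The quotient by [x^q - (alpha + beta p)] and its uniformizer [y] *)

Section Constacyclic.

Variables (p e s : nat) (R : finComUnitRingType) (F : finFieldType).
Variables (pi : {rmorphism R -> F}) (alpha beta alpha0 : R).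
Hypotheses (p_pr : prime p) (e_gt0 : (0 < e)%N).
Hypothesis natr_eq0 : forall n, (n%:R == 0 :> R) = (p ^ e %| n)%N.
Hypothesis pi_surj : forall z, exists a, pi a = z.
Hypothesis ker_pi : forall a, pi a = 0 -> exists b, a = b * p%:R.
Hypotheses (beta_unit : beta \is a GRing.unit).
Hypotheses (alpha0_unit : alpha0 \is a GRing.unit).
Hypothesis alpha0X : alpha0 ^+ (p ^ s) = alpha.

Let q := (p ^ s)%N.
Let q_gt0 : (0 < q)%N. Proof. by rewrite expn_gt0 prime_gt0. Qed.
Let h := constacyclic_poly q (alpha + beta * p%:R).
Let y := in_qpoly h (alpha0^-1 *: 'X - 1).

Lemma size_constacyclic_poly : size h = q.+1.
Proof. by rewrite /h /constacyclic_poly size_XnsubC. Qed.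

Lemma mk_monic_constacyclic : mk_monic h = h.
Proof.
by rewrite mk_monic_id ?size_constacyclic_poly // monicXnsubC.
Qed.

Let pe0 : p%:R ^+ e = 0 :> R.
Proof. by apply/eqP; rewrite -natrX natr_eq0. Qed.

Lemma pi_p : pi p%:R = 0.
Proof.
have /eqP : pi p%:R ^+ e = 0 by rewrite -rmorphXn pe0 rmorph0.
by rewrite expf_eq0 e_gt0 => /eqP.
Qed.

Lemma uniformizer_expE :
  exists w, y ^+ q = p%:R * (qpolyC h (beta / alpha) - y * w).
Proof.
have [w yE] := expr1D_prime_power s y p_pr; exists w.
have alphaV : alpha^-1 * alpha = 1 by rewrite mulVr // -alpha0X unitrX.
(* [1 + y] is the class of [alpha0^-1 x], whose [q]-th power is [alpha^-1 (alpha + beta p)]. *)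
suff : (1 + y) ^+ q = 1 + p%:R * qpolyC h (beta / alpha).
  rewrite yE -addrA => /addrI yqE.
  by rewrite mulrBr -yqE mulrA addrK.
have hx : in_qpoly h 'X ^+ q = qpolyC h (alpha + beta * p%:R).
  apply/eqP; rewrite -subr_eq0 -(rmorphXn (in_qpoly h)).
  rewrite -in_qpolyC -rmorphB.
  apply/eqP/val_inj; rewrite /= mk_monic_constacyclic.
  by rewrite Pdiv.RingMonic.rmodpp ?monicXnsubC.
have -> : 1 + y = qpolyC h alpha0^-1 * in_qpoly h 'X.
  by rewrite /y rmorphB rmorph1 addrC subrK -mul_polyC rmorphM /= in_qpolyC.
rewrite exprMn hx -rmorphXn exprVn alpha0X -rmorphM mulrDr alphaV.
rewrite rmorphD rmorph1 -(rmorph_nat (qpolyC h)) -rmorphM.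
by congr (_ + qpolyC h _); rewrite mulrCA mulrA mulrC.
Qed.

Lemma uniformizer_nilpotent : y ^+ (e * q) = 0.
Proof.
have [w yE] := uniformizer_expE.
rewrite mulnC exprM yE exprMn -(rmorph_nat (qpolyC h)) -rmorphXn pe0.
by rewrite rmorph0 mul0r.
Qed.

Lemma uniformizer_exp_assoc : exists u v, u * v = 1 /\ y ^+ q = p%:R * u.
Proof.
have [w yE] := uniformizer_expE.
have alpha_unit : alpha \is a GRing.unit by rewrite -alpha0X unitrX.
have bV : qpolyC h (beta / alpha) * qpolyC h (alpha / beta) = 1.
  by rewrite -rmorphM -mulrA mulKr // mulrV ?rmorph1.
have [|v uv] := @unit_sub_nilpotent _ _ _ (y * w) (e * q) bV.
  by rewrite exprMn uniformizer_nilpotent mul0r.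
by exists (qpolyC h (beta / alpha) - y * w), v.
Qed.

Lemma uniformizer_nilpotency : nilpotency_index y (e * q).
Proof.
split; [by rewrite muln_gt0 e_gt0 | exact: uniformizer_nilpotent |].
move=> j _ yj0; rewrite leqNgt; apply/negP => lt_j.
have [u [v [uv1 yE]]] := uniformizer_exp_assoc.
have : y ^+ (e.-1 * q + q.-1) = 0.
  (* The exponent is [e q - 1], split so that [y^q] can be replaced by [p u]. *)
  suff /subnK <- : (j <= e.-1 * q + q.-1)%N by rewrite exprD yj0 mulr0.
  by rewrite -ltnS -addnS prednK // addnC -mulSn prednK.
rewrite exprD mulnC exprM yE exprMn => /(congr1 (fun a => v ^+ e.-1 * a)).
(* The factor [v ^+ e.-1] cancels the power of [u], leaving [p^(e-1) y^(q-1) = 0]. *)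
rewrite mulr0 mulrA mulrCA -exprMn mulrC [v * u]mulrC uv1 expr1n mulr1.
rewrite -(rmorphXn (in_qpoly h)) -natrX -(rmorph_nat (in_qpoly h)) -rmorphM.
have -> : alpha0^-1 *: 'X - 1 = alpha0^-1 *: ('X - alpha0%:P).
  by rewrite scalerBr -[alpha0%:P]mulr1 mul_polyC scalerA mulVr // scale1r.
have size_y : (size (('X - alpha0%:P) ^+ q.-1) = q)%N.
  by rewrite size_exp_XsubC prednK.
rewrite exprZn mulrC -polyC_natr mul_polyC.
(* The polynomial has degree below [q], so it is its own representative and must vanish identically;
   its coefficient of index [q.-1] is then inspected. *)
move=> /(congr1 val); rewrite /= Pdiv.Ring.rmodp_small; last first.
  rewrite mk_monic_constacyclic size_constacyclic_poly ltnS.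
  rewrite (leq_trans (size_scale_leq _ _)) //.
  by rewrite (leq_trans (size_scale_leq _ _)) // size_y.
move=> /(congr1 (fun a : {poly R} => a`_q.-1)); rewrite !coefZ coef0.
have -> : (('X - alpha0%:P) ^+ q.-1)`_q.-1 = 1.
  have /monicP := monic_exp q.-1 (monicXsubC alpha0).
  by rewrite /lead_coef size_y.
move=> /(congr1 (fun a => a * alpha0 ^+ q.-1)); rewrite mul0r mulr1 exprVn.
(* What remains is [p^(e-1) = 0] in [R], contrary to the characteristic [p^e]. *)
rewrite divrK ?unitrX // => /eqP; rewrite natr_eq0.
by rewrite dvdn_Pexp2l ?prime_gt1 // leqNgt prednK ?leqnn.
Qed.

Let eval0 : {rmorphism {poly R} -> F} :=
  horner_eval (pi alpha0) \o map_poly pi.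

(** [h] takes the value [- beta p] at [alpha0], and [pi] kills [p]. *)
Let eval0_h : eval0 (mk_monic h) = 0.
Proof.
rewrite mk_monic_constacyclic /= /horner_eval rmorphB /= map_polyXn.
rewrite map_polyC /= !hornerE -rmorphXn -rmorphB -/q alpha0X opprD addrA.
by rewrite subrr sub0r rmorphN rmorphM pi_p mulr0 oppr0.
Qed.

Definition residue_map : {rmorphism {poly %/ h} -> F} :=
  qpoly_rmorphism eval0_h.

Lemma residue_mapE a : residue_map (in_qpoly h a) = pi a.[alpha0].
Proof.
apply: etrans (qpoly_lift_in_qpoly eval0_h a) _.
by rewrite /= /horner_eval horner_map.
Qed.

Lemma residue_map_surj z : exists a, residue_map a = z.
Proof.
have [a <-] := pi_surj z; exists (in_qpoly h a%:P).
by rewrite residue_mapE hornerC.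
Qed.

Lemma residue_map_uniformizer : residue_map y = 0.
Proof. by rewrite residue_mapE !hornerE mulVr // subrr rmorph0. Qed.

(** Write [a = d (x - alpha0) + a(alpha0)]. The first term is a multiple of [y] because
    [x - alpha0 = alpha0 y]; the second is a multiple of [p], hence of [y^q]. *)
Lemma ker_residue_map a : residue_map a = 0 -> exists b, a = b * y.
Proof.
rewrite -[a]in_qpolyK residue_mapE => /ker_pi[c aE].
have /factor_theorem[d dE] :
    root ((a : {poly R}) - (a : {poly R}).[alpha0]%:P) alpha0.
  by rewrite /root !hornerE subrr.
have [u [v [uv1 yE]]] := uniformizer_exp_assoc.
(* One factor [y] can be split off [y^q] because [q > 0]. *)
have pE : p%:R = v * y ^+ q.-1 * y.
  by rewrite -mulrA -exprSr prednK // yE mulrCA [v * u]mulrC uv1 mulr1.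
exists (in_qpoly h (alpha0 *: d) + in_qpoly h c%:P * (v * y ^+ q.-1)).
rewrite mulrDl -mulrA -pE -(rmorph_nat (in_qpoly h)) -!rmorphM -rmorphD.
congr (in_qpoly h _); rewrite -polyC_natr -polyCM -aE.
rewrite -[LHS](subrK (a : {poly R}).[alpha0]%:P) dE; congr (_ + _).
rewrite -scalerAl scalerAr scalerBr scalerA mulrV // scale1r.
by rewrite -mul_polyC mulr1.
Qed.

End Constacyclic.

Theorem theorem5p4 (p e r s : nat) (R : finComUnitRingType)
    (alpha beta alpha0 : R) :
  prime p -> (0 < e)%N -> (0 < r)%N -> galois_ring p e r R ->
  alpha \is a GRing.unit -> beta \is a GRing.unit ->
  alpha0 \is a GRing.unit -> alpha0 ^+ (p ^ s) = alpha ->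
  let h := constacyclic_poly (p ^ s) (alpha + beta * p%:R) in
  let y := in_qpoly h (alpha0^-1 *: 'X - 1) in
  [/\ chain_ring {poly %/ h},
      maximal_ideal (principal_ideal y),
      has_residue_field (principal_ideal y) (p ^ r),
      nilpotency_index y (e * p ^ s)
    & forall I : {set {poly %/ h}},
        is_ideal I <->
        exists2 i, (i <= e * p ^ s)%N & I = principal_ideal (y ^+ i)].
Proof.
move=> p_pr e_gt0 r_gt0 galR _ beta_unit alpha0_unit alpha0X h y.
have natr_eq0 := galois_ring_natr_eq0 p_pr e_gt0 galR.
have [F cardF [pi pi_surj ker_pi]] := galois_ring_residue p_pr e_gt0 r_gt0 galR.
have y_nil : nilpotency_index y (e * p ^ s) by exact: uniformizer_nilpotency.
pose phi :=
  @residue_map p e s R F pi alpha beta alpha0 p_pr e_gt0 natr_eq0 alpha0X.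
have phi_surj : forall z, exists a, phi a = z by exact: residue_map_surj.
have ker_phi : forall a, phi a = 0 -> exists b, a = b * y.
  exact: ker_residue_map.
have phi_y : phi y = 0 by exact: residue_map_uniformizer.
split=> //.
- exact: chain_ring_nilpotent_generator phi_surj ker_phi phi_y y_nil.
- exact: maximal_principal phi_surj ker_phi phi_y y_nil.
- by rewrite -cardF; exact: residue_field_principal phi_surj ker_phi phi_y.
- exact: is_idealP phi_surj ker_phi y_nil.
Qed.
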